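(* Let $A\in\mathbb{R}^{n\times n}$, $b_1,\dots,b_m\in\mathbb{R}^n$ with $m\ge1$, and $T>0$. Let $C\subseteq\Delta_m$ be nonempty, compact and convex, and let $\mathcal L_C:=\operatorname{lin}(C-C)$. Suppose that $\operatorname{Ker}\Phi_T\cap\mathcal L_C=\{0\}$, $C\cap X_T\neq\emptyset$ and $\mathcal L_C\neq\{0\}$. Define $$\kappa_{C,T}:=\min_{v\in\mathcal L_C,\ \|v\|=1}\|\Phi_T(v)\|_{\rm F},\qquad \beta_T:=\max_{p\in C}\lambda_{\max}(W(p,T)).$$ Then $\kappa_{C,T}>0$, and, for every $p\in C\cap X_T$ and every $v\in\mathcal L_C$, $$v^\top\nabla^2f_{\rm V}(p)v\ge\mu_{\rm V}\|v\|^2,\quad \mu_{\rm V}:=\frac{\kappa_{C,T}^2}{\beta_T^2},\qquad\quad v^\top\nabla^2f_{\rm A}(p)v\ge\mu_{\rm A}\|v\|^2,\quad \mu_{\rm A}:=\frac{2\kappa_{C,T}^2}{\beta_T^3}.$$ Consequently, $f_{\rm V}$ and $f_{\rm A}$ are strongly convex on $C\cap X_T$ along $\mathcal L_C$ with parameters $\mu_{\rm V}$ and $\mu_{\rm A}$, respectively; that is, for $(f,\mu)\in\{(f_{\rm V},\mu_{\rm V}),(f_{\rm A},\mu_{\rm A})\}$ and all $p,q\in C\cap X_T$, $$f(q)\ge f(p)+\nabla f(p)^\top(q-p)+\frac{\mu}{2}\|q-p\|^2.$$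
   Context: $\Delta_m:=\{p\in\mathbb{R}^m\mid p_i\ge0,\ \sum_{i=1}^m p_i=1\}$; $W_i(T):=\int_0^T e^{At}b_ib_i^\top e^{A^\top t}\,dt$; $\Phi_T:\mathbb{R}^m\to\mathbb{S}^n$ (real symmetric $n\times n$ matrices) is the linear map $\Phi_T(v):=\sum_{i=1}^m v_iW_i(T)$, and $W(p,T):=\Phi_T(p)$; $X_T:=\{p\in\mathbb{R}^m\mid W(p,T)\succ O\}$ (positive definite), an open convex set; for $p\in X_T$, $f_{\rm V}(p):=-\log\det W(p,T)$ and $f_{\rm A}(p):=\operatorname{tr}(W(p,T)^{-1})$. $\|\cdot\|$ is the Euclidean norm, $\|\cdot\|_{\rm F}$ the Frobenius norm, $\lambda_{\max}$ the largest eigenvalue, $C-C=\{p-q\mid p,q\in C\}$, $\operatorname{lin}$ is linear span. *)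

(* Defs.v *)
From HB Require Import structures.
From mathcomp Require Import all_boot all_order all_algebra.
From mathcomp Require Import all_classical all_reals all_analysis.
Import Order.TTheory GRing.Theory Num.Theory.
Import numFieldNormedType.Exports.

Set Implicit Arguments.
Unset Strict Implicit.
Unset Printing Implicit Defensive.

Local Open Scope classical_set_scope.
Local Open Scope ring_scope.

Section Extrema.
Variable R : realType.
Implicit Types (E : set R) (x : R).

Definition is_min E x := E x /\ lbound E x.
Definition is_max E x := E x /\ ubound E x.

(* equal to 0 when the extremum is not attained *)
Definition set_min E : R := xget 0 (is_min E).
Definition set_max E : R := xget 0 (is_max E).

End Extrema.

Section Matrices.
Variable R : realType.

(* The library norm on matrices is the sup norm (same topology), hence the
   explicit Euclidean and Frobenius norms. *)
Definition enorm m (v : 'cV[R]_m) : R := Num.sqrt (\sum_i v i 0 ^+ 2).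

Definition frob m n (M : 'M[R]_(m, n)) : R :=
  Num.sqrt (\sum_i \sum_j M i j ^+ 2).

Definition posdef n (M : 'M[R]_n) : Prop :=
  M^T = M /\ forall x : 'cV[R]_n, x != 0 -> 0 < (x^T *m M *m x) 0 0.

(* meant for matrices all of whose eigenvalues are real *)
Definition lambda_max n (M : 'M[R]_n) : R := set_max [set a | eigenvalue M a].

Definition expmx n (M : 'M[R]_n) : 'M[R]_n :=
  limn (series (fun k => (k`!%:R)^-1 *: M ^+ k)).

Definition mxint m n (T : R) (F : R -> 'M[R]_(m, n)) : 'M[R]_(m, n) :=
  \matrix_(i, j) \int[lebesgue_measure]_(t in `[0, T]) F t i j.

End Matrices.

Section Vectors.
Variables (R : realType) (m : nat).
Implicit Types (S : set 'cV[R]_m) (f : 'cV[R]_m -> R) (p v : 'cV[R]_m).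

Definition simplex : set 'cV[R]_m :=
  [set p | (forall i, 0 <= p i 0) /\ \sum_i p i 0 = 1].

Definition lin S : set 'cV[R]_m :=
  [set v | exists k (c : 'I_k -> R) (u : 'I_k -> 'cV[R]_m),
     (forall i, S (u i)) /\ v = \sum_i c i *: u i].

Definition partial (i : 'I_m) f : 'cV[R]_m -> R :=
  fun p => 'D_(delta_mx i 0) f p.

Definition grad f p : 'cV[R]_m := \col_i partial i f p.

Definition hess f p : 'M[R]_m := \matrix_(i, j) partial i (partial j f) p.

(* first-order form of strong convexity *)
Definition strongly_convex_on S f (mu : R) : Prop :=
  forall p q, S p -> S q ->
    f q >= f p + ((grad f p)^T *m (q - p)) 0 0 + mu / 2 * enorm (q - p) ^+ 2.

End Vectors.

Section Gramian.
Variables (R : realType) (n m : nat).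
Variables (A : 'M[R]_n) (b : 'I_m -> 'cV[R]_n) (T : R).

Definition gramian (i : 'I_m) : 'M[R]_n :=
  mxint T (fun t => expmx (t *: A) *m b i *m (b i)^T *m expmx (t *: A^T)).

Definition Phi (v : 'cV[R]_m) : 'M[R]_n := \sum_i v i 0 *: gramian i.

Definition X_ : set 'cV[R]_m := [set p | posdef (Phi p)].

(* Only the values on the open set [X_] matter; elsewhere [ln] and [invmx] may
   return their default values. *)
Definition fV (p : 'cV[R]_m) : R := - ln (\det (Phi p)).
Definition fA (p : 'cV[R]_m) : R := \tr (invmx (Phi p)).

Variable C : set 'cV[R]_m.

Definition L_ : set 'cV[R]_m := lin [set p - q | p in C & q in C].

Definition kappa_set : set R :=
  [set frob (Phi v) | v in [set v | L_ v /\ enorm v = 1]].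
Definition kappa : R := set_min kappa_set.

Definition beta_set : set R := [set lambda_max (Phi p) | p in C].
Definition beta : R := set_max beta_set.

Definition muV : R := kappa ^+ 2 / beta ^+ 2.
Definition muA : R := 2 * kappa ^+ 2 / beta ^+ 3.

End Gramian.

(* Main.v *)
From HB Require Import structures.
Require Import Defs.
From mathcomp Require Import all_boot all_order all_algebra.
From mathcomp Require Import all_classical all_reals all_analysis.
From mathcomp Require Import ring.
Import Order.TTheory GRing.Theory Num.Theory.
Import numFieldNormedType.Exports.

Set Implicit Arguments.
Unset Strict Implicit.
Unset Printing Implicit Defensive.

Local Open Scope classical_set_scope.
Local Open Scope ring_scope.

(** Write W(p) for the Gramian combination and S = W(p)^-1.  Differentiating
    along a direction v, with V = W(v), gives
      D(-log det W) = - tr(S V),     D^2(-log det W) = tr(S V S V),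
      D(tr W^-1)    = - tr(S V S),   D^2(tr W^-1)    = 2 tr(S V S V S)
    ([hess_logdet_form], [hess_trinv_form]); these follow from Jacobi's formula
    for the determinant and from the derivative - S V S of the inverse.

    The lower bounds are matrix algebra.  If lam is the largest eigenvalue of
    W(p), then S >= lam^-1 I in the Loewner order, and the trace of a product
    of two positive semidefinite matrices is nonnegative; replacing the factors
    S by lam^-1 I one after the other bounds the two Hessian forms below by
    |V|^2 / lam^2 and 2 |V|^2 / lam^3, for the Frobenius norm
    ([trace_invmx2_ge], [trace_invmx3_ge]).  Since lam <= beta and
    |V| >= kappa |v| for v in L, this is the claimed curvature.

    That kappa and beta are attained is compactness.  The span L is a linear
    subspace of a finite-dimensional space, hence closed, so its unit sphere is
    compact, and the kernel hypothesis makes the minimum positive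
    ([min_frob_pencil]).  The number beta is the maximum of the continuous
    function x^T W(p) x over the product of C with the unit sphere
    ([is_max_lambda_max]), because the largest eigenvalue of a symmetric matrix is
    the maximum of its Rayleigh quotient ([lambda_max_rayleigh]).

    Strong convexity then follows by integrating the Hessian bound twice along
    the segment from p to q ([taylor2_ge]), which stays in C and in the set
    where W is positive definite.

    All this is done for a pencil p |-> sum_i p_i G_i of arbitrary symmetric
    matrices G_i.  The Gramians W_i are symmetric because transposition exchanges
    the two exponentials in their integrands ([gramian_sym]). *)

(** * Positive semidefinite matrices *)

Section Psd.
Variable R : realType.

Definition qform n (M : 'M[R]_n) (x : 'cV[R]_n) : R := (x^T *m M *m x) 0 0.
Definition psd n (M : 'M[R]_n) : Prop := M^T = M /\ forall x, 0 <= qform M x.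

Lemma qformD n (M N : 'M[R]_n) x : qform (M + N) x = qform M x + qform N x.
Proof. by rewrite /qform mulmxDr mulmxDl mxE. Qed.

Lemma qformZ n a (M : 'M[R]_n) x : qform (a *: M) x = a * qform M x.
Proof. by rewrite /qform -scalemxAr -scalemxAl mxE. Qed.

Lemma qform_congr m n (M : 'M[R]_m) (B : 'M[R]_(m, n)) x :
  qform (B^T *m M *m B) x = qform M (B *m x).
Proof. by rewrite /qform trmx_mul !mulmxA. Qed.

Lemma qform1 n (x : 'cV[R]_n) : qform 1%:M x = \sum_i x i 0 ^+ 2.
Proof.
by rewrite /qform mulmx1 mxE; apply: eq_bigr => i _; rewrite mxE expr2.
Qed.

Lemma qform1_ge0 n (x : 'cV[R]_n) : 0 <= qform 1%:M x.
Proof. by rewrite qform1 sumr_ge0 // => i _; rewrite sqr_ge0. Qed.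

Lemma qform1_eq0 n (x : 'cV[R]_n) : (qform 1%:M x == 0) = (x == 0).
Proof.
rewrite qform1; apply/idP/eqP => [|->]; last first.
  by rewrite big1 // => i _; rewrite mxE expr0n.
rewrite psumr_eq0; last by move=> i _; rewrite sqr_ge0.
move=> /allP h; apply/colP => i; rewrite mxE; apply/eqP.
by rewrite -sqrf_eq0; apply: h; rewrite mem_index_enum.
Qed.

Lemma psdD n (M N : 'M[R]_n) : psd M -> psd N -> psd (M + N).
Proof.
move=> [MT M0] [NT N0]; split=> [|x]; first by rewrite raddfD /= MT NT.
by rewrite qformD addr_ge0.
Qed.

Lemma psdZ n a (M : 'M[R]_n) : 0 <= a -> psd M -> psd (a *: M).
Proof.
move=> a0 [MT M0]; split=> [|x]; first by rewrite linearZ /= MT.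
by rewrite qformZ mulr_ge0.
Qed.

Lemma psd_congr m n (M : 'M[R]_m) (B : 'M[R]_(m, n)) :
  psd M -> psd (B^T *m M *m B).
Proof.
move=> [MT M0]; split=> [|x]; last by rewrite qform_congr.
by rewrite !trmx_mul trmxK MT mulmxA.
Qed.

Lemma psd1 n : psd (1%:M : 'M[R]_n).
Proof. by split=> [|x]; [rewrite trmx1|exact: qform1_ge0]. Qed.

(** The form at t x + M x is 2 t |M x|^2 plus a constant, so it would be negative
    for some t if M x were nonzero. *)
Lemma psd_ker n (M : 'M[R]_n) x : psd M -> qform M x = 0 -> M *m x = 0.
Proof.
move=> [MT M0] Mx0; apply/eqP; rewrite -qform1_eq0; apply/eqP.
set u := M *m x; set a := qform 1%:M u; set b := qform M u.
have a0 : 0 <= a by exact: qform1_ge0.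
have qE t : qform M (t *: x + u) = 2 * t * a + b.
  have xM : x^T *m M = u^T by rewrite trmx_mul MT.
  have uu : u^T *m u = (a%:M : 'M[R]_1).
    by rewrite [LHS]mx11_scalar /a /qform mulmx1.
  have ux : u^T *m x = 0.
    by rewrite [LHS]mx11_scalar -xM -/(qform M x) Mx0 raddf0.
  have -> : qform M (t *: x + u) = ((t *: x^T + u^T) *m M *m (t *: x + u)) 0 0.
    by rewrite /qform [_^T]linearP.
  rewrite mulmxDl -scalemxAl xM.
  rewrite mulmxDr !mulmxDl -!scalemxAl -!scalemxAr uu -[u^T *m M *m x]mulmxA uu.
  rewrite ux /b /qform; set w := u^T *m M *m u.
  by rewrite !mxE /= mulr1n; ring.
(* This t makes the affine function 2 t a + b equal to -1. *)
have := M0 (- (b + 1) / (2 * a) *: x + u).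
rewrite qE; have [//|an0] := eqVneq a 0.
suff -> : 2 * (- (b + 1) / (2 * a)) * a + b = - 1 by rewrite oppr_ge0 ler10.
by field.
Qed.

(** Cholesky factorisation, by induction on the size: the Schur complement of the
    first diagonal entry is of the form E^T M E, hence positive semidefinite. *)
Lemma psd_factor n (M : 'M[R]_n) : psd M -> exists B : 'M[R]_n, M = B^T *m B.
Proof.
elim: n M => [|n IHn] M psdM; first by exists 0; apply/matrixP => -[].
pose M' : 'M[R]_(1 + n) := M.
have symM : M'^T = M' by case: psdM.
set a := M' 0 0; set c := dlsubmx M'; set D := drsubmx M'.
have ME : M' = block_mx a%:M c^T c D.
  rewrite -[LHS]submxK; congr block_mx; last first.
    by rewrite /c -{2}symM -trmx_ursub trmxK.
  by apply/matrixP => i j; rewrite !ord1 !mxE !lshift0.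
have qe0 : qform M' (delta_mx 0 0) = a.
  by rewrite /qform trmx_delta -rowE -colE !mxE.
have a0 : 0 <= a by rewrite -qe0; case: psdM => _; exact.
have ac : a = 0 -> c = 0.
  move=> aeq0; have col0 : col 0 M' = 0.
    by rewrite colE; apply: (psd_ker (psdM : psd M')); rewrite qe0.
  by apply/colP => i; have /colP/(_ (rshift 1 i)) := col0; rewrite !mxE lshift0.
have aac : (a * a^-1) *: c^T = c^T.
  have [/ac ->|an0] := eqVneq a 0; first by rewrite raddf0 scaler0.
  by rewrite mulfV // scale1r.
(* The columns of E are chosen such that M' *m E has a zero first row.  This
   includes the case a = 0, where 0^-1 = 0 and c = 0. *)
pose E : 'M[R]_(1 + n, n) := col_mx (- a^-1 *: c^T) 1%:M.
have psdS : psd (D - a^-1 *: (c *m c^T)).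
  have -> : D - a^-1 *: (c *m c^T) = E^T *m M' *m E.
    rewrite -mulmxA ME /E mul_block_col mul_scalar_mx scalerA mulrN scaleNr.
    rewrite scaleNr aac mulmx1 addNr tr_col_mx mul_row_col mulmx0 add0r.
    by rewrite trmx1 mul1mx mulmx1 mulmxN -scalemxAr addrC.
  exact: psd_congr.
have [B SB] := IHn _ psdS.
suff: exists B' : 'M[R]_(1 + n), M' = B'^T *m B' by [].
exists (block_mx (Num.sqrt a)%:M ((Num.sqrt a)^-1 *: c^T) 0 B : 'M[R]_(1 + n)).
have sqa : Num.sqrt a * Num.sqrt a = a by rewrite -expr2 sqr_sqrtr.
have sac : (Num.sqrt a * (Num.sqrt a)^-1) *: c^T = c^T.
  have [an0|an0] := eqVneq a 0; first by rewrite (ac an0) raddf0 scaler0.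
  by rewrite mulfV ?scale1r // sqrtr_eq0 -ltNge lt0r an0.
rewrite ME tr_block_mx mulmx_block.
have cT : ((Num.sqrt a)^-1 *: c^T)^T = (Num.sqrt a)^-1 *: c.
  by rewrite [LHS]linearZ /= trmxK.
rewrite cT !tr_scalar_mx !trmx0 mulmx0 !mul0mx !addr0 -scalar_mxM sqa.
rewrite mul_scalar_mx mul_mx_scalar !scalerA sac.
have -> : (Num.sqrt a / Num.sqrt a) *: c = c.
  by apply: trmx_inj; rewrite [LHS]linearZ.
rewrite -scalemxAl -scalemxAr scalerA -invfM sqa.
by rewrite mulmx0 addr0 -SB addrC subrK.
Qed.

(** With M = B^T B the trace is that of B N B^T, whose diagonal entries are values
    of the quadratic form of N. *)
Lemma trace_psd_mul n (M N : 'M[R]_n) : psd M -> psd N -> 0 <= \tr (M *m N).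
Proof.
move=> /psd_factor[B ->] [_ N0].
rewrite -mulmxA mxtrace_mulC sumr_ge0 // => i _.
have -> : (B *m N *m B^T) i i = qform N (row i B)^T.
  by rewrite /qform trmxK -row_mul !mxE; apply: eq_bigr => k _; rewrite !mxE.
exact: N0.
Qed.

Lemma posdef_psd n (M : 'M[R]_n) : posdef M -> psd M.
Proof.
move=> [MT M0]; split=> // x; have [->|/M0/ltW //] := eqVneq x 0.
by rewrite /qform mulmx0 mxE.
Qed.

Lemma posdef_unit n (M : 'M[R]_n) : posdef M -> M \in unitmx.
Proof.
move=> [MT M0]; rewrite -row_free_unit -kermx_eq0; apply/rowV0P => v.
move=> /sub_kermxP vM0; apply/eqP; apply: contraT => vn0.
have := M0 v^T; rewrite trmxK vM0 mul0mx mxE ltxx => -> //.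
by apply: contra vn0 => /eqP v0; rewrite -[v]trmxK v0 raddf0.
Qed.

Lemma posdef_det_gt0 n (M : 'M[R]_n) : posdef M -> 0 < \det M.
Proof.
move=> pM; have := posdef_unit pM; have [B ->] := psd_factor (posdef_psd pM).
rewrite unitmxE unitfE => d0; rewrite lt0r d0 det_mulmx det_tr.
by rewrite -expr2 sqr_ge0.
Qed.

Lemma trace_sqr_frob n (V : 'M[R]_n) : V^T = V -> \tr (V *m V) = frob V ^+ 2.
Proof.
move=> VT; rewrite /frob sqr_sqrtr; last first.
  by rewrite sumr_ge0 // => i _; rewrite sumr_ge0 // => j _; rewrite sqr_ge0.
apply: eq_bigr => i _; rewrite mxE; apply: eq_bigr => j _.
by rewrite -{2}VT mxE expr2.
Qed.

Section InverseBounds.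
Variables (n : nat) (M V : 'M[R]_n) (lam : R).
Hypotheses (pM : posdef M) (lam_gt0 : 0 < lam).
Hypothesis (M_le : psd (lam%:M - M)) (VT : V^T = V).

Local Notation S := (invmx M).
Local Notation c := lam^-1.

Let ST : S^T = S. Proof. by rewrite trmx_inv pM.1. Qed.

Let psdV N : psd N -> psd (V *m N *m V).
Proof. by move=> /(psd_congr V); rewrite VT. Qed.

Lemma psd_invmx : psd S.
Proof.
have -> : S = S^T *m M *m S by rewrite ST mulVmx ?mul1mx // posdef_unit.
exact/psd_congr/posdef_psd.
Qed.

(** An identity proves S >= c I for c = 1 / lam:
    S - c I = (S - c I) M (S - c I) + c^2 (lam I - M),
    a sum of a congruence of M and of a multiple of lam I - M. *)
Lemma invmx_ge : psd (S - c%:M).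
Proof.
have -> : S - c%:M = (S - c%:M)^T *m M *m (S - c%:M) + c ^+ 2 *: (lam%:M - M).
  have uM := posdef_unit pM.
  have -> : (S - c%:M)^T = S - c%:M by rewrite [LHS]linearB /= tr_scalar_mx ST.
  rewrite mulmxBl mulVmx // mulmxBl mul1mx mul_scalar_mx -scalemxAl mulmxBr.
  rewrite mulmxV // mul_mx_scalar !scalerBr !scalerA.
  have lam0 : lam != 0 by rewrite gt_eqF.
  apply/matrixP => i j; rewrite !mxE; move: (S i j) (M i j) => x y.
  by case: (i == j); rewrite ?mulr1n ?mulr0n; field.
by apply: psdD; [exact/psd_congr/posdef_psd|apply: psdZ; rewrite ?sqr_ge0].
Qed.

(** The square of a matrix that is at least c I is at least c^2 I:
    S^2 - c^2 I = (S - c I)^2 + 2 c (S - c I). *)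
Lemma invmx_sqr_ge : psd (S *m S - (c ^+ 2)%:M).
Proof.
have ScT : (S - c%:M)^T = S - c%:M by case: invmx_ge.
have -> : S *m S - (c ^+ 2)%:M =
          (S - c%:M)^T *m 1%:M *m (S - c%:M) + (2 * c) *: (S - c%:M).
  rewrite ScT mulmx1 mulmxBr !mulmxBl mul_mx_scalar !mul_scalar_mx.
  rewrite scale_scalar_mx scalerBr.
  have lam0 : lam != 0 by rewrite gt_eqF.
  move: (S *m S) => SS; apply/matrixP => i j; rewrite !mxE.
  by case: (i == j); rewrite ?mulr1n ?mulr0n; field.
apply: psdD; first exact/psd_congr/psd1.
by apply: psdZ invmx_ge; rewrite mulr_ge0 // invr_ge0 ltW.
Qed.

Let trace_VSV : c * frob V ^+ 2 <= \tr (V *m S *m V).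
Proof.
have := trace_psd_mul invmx_ge (psdV (@psd1 n)).
rewrite mulmx1 mulmxBl mul_scalar_mx raddfB /= linearZ /= trace_sqr_frob //.
by rewrite subr_ge0 mulmxA mxtrace_mulC mulmxA.
Qed.

(** The two inverses are replaced by lam^-1 in turn: in tr(S (V S V)) against the
    positive semidefinite matrix V S V, then in tr(V S V) against V V. *)
Lemma trace_invmx2_ge :
  frob V ^+ 2 / lam ^+ 2 <= \tr (S *m V *m S *m V).
Proof.
have := trace_psd_mul invmx_ge (psdV psd_invmx).
rewrite mulmxBl mul_scalar_mx raddfB /= linearZ /= subr_ge0 !mulmxA.
apply: le_trans.
by rewrite -exprVn expr2 mulrC -mulrA -expr2 ler_pM2l ?invr_gt0 ?trace_VSV.
Qed.

(** By cyclicity the trace is tr(S^2 (V S V)), and S^2 is replaced by lam^-2 in a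
    single step. *)
Lemma trace_invmx3_ge :
  frob V ^+ 2 / lam ^+ 3 <= \tr (S *m V *m S *m V *m S).
Proof.
have := trace_psd_mul invmx_sqr_ge (psdV psd_invmx).
rewrite mulmxBl mul_scalar_mx raddfB /= linearZ /= subr_ge0 !mulmxA.
rewrite [\tr (_ *m S)]mxtrace_mulC !mulmxA.
apply: le_trans; rewrite -exprVn [c ^+ 3]exprSr mulrC -mulrA.
by rewrite ler_pM2l ?exprn_gt0 ?invr_gt0 ?trace_VSV.
Qed.

End InverseBounds.
End Psd.

(** * Limits of matrices, unit spheres and Rayleigh quotients *)

Section MatrixLimits.
Variable R : realType.

Lemma cvg_mx (T : Type) (F : set_system T) m n
    (M : T -> 'M[R]_(m, n)) (L : 'M[R]_(m, n)) :
  Filter F -> (forall i j, M x i j @[x --> F] --> L i j) ->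
  M x @[x --> F] --> L.
Proof.
move=> FF cM; apply/cvg_mx_entourageP => A entA.
apply: filter_forall => i; apply: filter_forall => j.
have /cvg_entourageP/(_ A entA) := cM i j.
by apply: (@filterS T F) => x /= ?; rewrite inE.
Qed.

Lemma cvg_mxE (T : Type) (F : set_system T) m n
    (M : T -> 'M[R]_(m, n)) (L : 'M[R]_(m, n)) :
  Filter F -> M x @[x --> F] --> L ->
  forall i j, M x i j @[x --> F] --> L i j.
Proof.
move=> FF cM i j.
pose ev (N : 'M[R]_(m, n)) := N i j.
have cE : {for L, continuous ev} by exact: coord_continuous.
exact: (@continuous_cvg _ _ _ F FF M ev L cE cM).
Qed.

Lemma cvg_mulmx (T : Type) (F : set_system T) m n p
    (M : T -> 'M[R]_(m, n)) (N : T -> 'M[R]_(n, p))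
    (K : 'M[R]_(m, n)) (L : 'M[R]_(n, p)) :
  Filter F -> M x @[x --> F] --> K -> N x @[x --> F] --> L ->
  (M x *m N x) @[x --> F] --> K *m L.
Proof.
move=> FF cM cN; apply: cvg_mx => i j; rewrite mxE.
under eq_cvg do rewrite mxE.
apply: cvg_big => [|k _]; first exact: add_continuous.
by apply: cvgM; apply: cvg_mxE.
Qed.

Lemma cvg_trmx (T : Type) (F : set_system T) m n
    (M : T -> 'M[R]_(m, n)) (K : 'M[R]_(m, n)) :
  Filter F -> M x @[x --> F] --> K -> (M x)^T @[x --> F] --> K^T.
Proof.
move=> FF cM; apply: cvg_mx => i j; rewrite mxE.
by under eq_cvg do rewrite mxE; apply: cvg_mxE.
Qed.

(** Transposition carries Heine-Borel for row vectors to column vectors. *)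
Lemma cV_bounded_closed_compact n (A : set 'cV[R]_n) (B : R) :
  (forall x, A x -> forall i, `|x i 0| <= B) -> closed A -> compact A.
Proof.
move=> bA cA.
have trC p q : continuous (@trmx R p q).
  by move=> x; exact: (@cvg_trmx _ (nbhs x) p q id x _ (@cvg_id _ _)).
have -> : A = trmx @` (trmx @^-1` A : set 'rV[R]_n).
  apply/seteqP; split=> [x Ax|_ [x Ax <-] //].
  by exists x^T; rewrite /= trmxK.
apply: continuous_compact; first by apply: continuous_subspaceT; exact: trC.
apply: bounded_closed_compact; last first.
  by apply: closed_comp => // x _; exact: trC.
exists `|B|; split=> [|r Br x /= Ax]; first exact: num_real.
have r0 : 0 <= r by rewrite ltW // (le_lt_trans _ Br).
rewrite /Num.Def.normr /= mx_normrE; apply: bigmax_le => //= -[i j] _ /=.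
rewrite ord1 (le_trans _ (ltW Br)) // (le_trans _ (ler_norm B)) //.
by have := bA _ Ax j; rewrite mxE.
Qed.

Lemma cvg_qform (T : Type) (F : set_system T) n (M : T -> 'M[R]_n)
    (x : T -> 'cV[R]_n) (K : 'M[R]_n) (y : 'cV[R]_n) :
  Filter F -> M t @[t --> F] --> K -> x t @[t --> F] --> y ->
  qform (M t) (x t) @[t --> F] --> qform K y.
Proof.
move=> FF cM cx; rewrite /qform; apply: cvg_mxE.
by apply: cvg_mulmx => //; apply: cvg_mulmx => //; exact: cvg_trmx.
Qed.

Lemma qform_continuous n (M : 'M[R]_n) : continuous (qform M).
Proof.
move=> x.
exact: (@cvg_qform _ (nbhs x) _ (fun=> M) id M x _ (cvg_cst _) cvg_id).
Qed.

Lemma enormE n (v : 'cV[R]_n) : enorm v ^+ 2 = qform 1%:M v.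
Proof.
rewrite qform1 sqr_sqrtr // sumr_ge0 // => i _; exact: sqr_ge0.
Qed.

Lemma enorm_eq1 n (v : 'cV[R]_n) : enorm v = 1 <-> qform 1%:M v = 1.
Proof.
rewrite -enormE; split=> [->|/eqP]; first by rewrite expr1n.
rewrite sqrf_eq1 => /orP[/eqP //|/eqP v1].
by have : 0 <= enorm v by [exact: sqrtr_ge0]; rewrite v1 oppr_ge0 ler10.
Qed.

Lemma enormZ n a (v : 'cV[R]_n) : enorm (a *: v) = `|a| * enorm v.
Proof.
rewrite /enorm -sqrtr_sqr -sqrtrM ?sqr_ge0 // mulr_sumr; congr Num.sqrt.
by apply: eq_bigr => i _; rewrite mxE exprMn.
Qed.

Lemma sphere_closed n : closed [set x : 'cV[R]_n | enorm x = 1].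
Proof.
have -> : [set x : 'cV[R]_n | enorm x = 1] = (qform 1%:M) @^-1` [set 1].
  by apply/seteqP; split=> x /= /enorm_eq1.
apply: closed_comp; last exact: closed_eq.
by move=> x _; exact: qform_continuous.
Qed.

Lemma sphere_bounded n (x : 'cV[R]_n) i : enorm x = 1 -> `|x i 0| <= 1.
Proof.
move=> /enorm_eq1; rewrite qform1 => x1.
rewrite -(ler_pXn2r (n := 2)) ?nnegrE //.
rewrite expr1n real_normK ?num_real // -x1 (bigD1 i) //= lerDl.
by rewrite sumr_ge0 // => j _; rewrite sqr_ge0.
Qed.

Lemma sphere_compact n : compact [set x : 'cV[R]_n | enorm x = 1].
Proof.
apply: (cV_bounded_closed_compact (B := 1)); last exact: sphere_closed.
by move=> x x1 i; exact: sphere_bounded.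
Qed.

Lemma enorm_gt0 n (v : 'cV[R]_n) : v != 0 -> 0 < enorm v.
Proof.
by move=> v0; rewrite lt0r sqrtr_ge0 andbT -sqrf_eq0 enormE qform1_eq0.
Qed.

Lemma enorm_normalize n (v : 'cV[R]_n) :
  v != 0 -> enorm ((enorm v)^-1 *: v) = 1.
Proof.
move=> v0; have vp := enorm_gt0 v0.
by rewrite enormZ ger0_norm ?invr_ge0 ?ltW // mulVf // gt_eqF.
Qed.

Lemma sphere_nonempty n : (0 < n)%N -> [set x : 'cV[R]_n | enorm x = 1] !=set0.
Proof.
case: n => // n _; exists ((enorm (const_mx 1 : 'cV[R]_n.+1))^-1 *: const_mx 1).
apply: enorm_normalize; apply/eqP => /colP/(_ 0)/eqP.
by rewrite !mxE oner_eq0.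
Qed.

Lemma is_max_set_max (E : set R) x : is_max E x -> set_max E = x.
Proof.
move=> mx; have := xgetPex 0 (ex_intro _ x mx).
rewrite -/(set_max E) => -[E1 u1]; apply/eqP; rewrite eq_le.
by rewrite mx.2 //= u1 //; case: mx.
Qed.

(** A unit vector at which the form of lam I - M vanishes lies in the kernel of
    that matrix, so it is an eigenvector for lam; no eigenvalue exceeds lam because
    lam I - M is positive semidefinite. *)
Lemma lambda_max_eq n (M : 'M[R]_n) lam x :
  psd (lam%:M - M) -> enorm x = 1 -> qform M x = lam -> lambda_max M = lam.
Proof.
move=> psdL x1 Mx.
have x1' : qform 1%:M x = 1 by exact/enorm_eq1.
have lamx y : qform (lam%:M - M) y = lam * qform 1%:M y - qform M y.
  by rewrite qformD -scaleN1r qformZ mulN1r -[lam%:M]scalemx1 qformZ.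
have MT : M^T = M.
  by case: psdL; rewrite linearB /= tr_scalar_mx => /addrI /oppr_inj.
apply: (@is_max_set_max _ lam); split.
  have /psd_ker := psdL; move=> /(_ x); rewrite lamx x1' Mx mulr1 subrr.
  move=> /(_ erefl); rewrite mulmxBl mul_scalar_mx => /eqP.
  rewrite subr_eq0 => /eqP lx.
  apply/eigenvalueP; exists x^T.
    by rewrite -{1}MT -trmx_mul -lx linearZ.
  apply/eqP => x0; move: x1'; rewrite /qform x0 !mul0mx mxE => /eqP.
  by rewrite eq_sym oner_eq0.
move=> a /eigenvalueP[v vM v0]; case: psdL => _ /(_ v^T).
rewrite lamx /qform trmxK vM -scalemxAl mulmx1 [X in _ - X]mxE -mulrBl.
rewrite pmulr_lge0 ?subr_ge0 //.
rewrite -[X in X *m _]trmxK -[_^T^T]mulmx1.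
rewrite lt0r [X in _ && X]qform1_ge0 andbT qform1_eq0.
by apply: contra v0 => /eqP v0; rewrite -[v]trmxK v0 raddf0.
Qed.

(** The quadratic form attains its maximum on the compact unit sphere, and
    [lambda_max_eq] identifies this maximum with the largest eigenvalue. *)
Lemma lambda_max_rayleigh n (M : 'M[R]_n) : (0 < n)%N -> M^T = M ->
  psd ((lambda_max M)%:M - M) /\
  exists2 x, enorm x = 1 & qform M x = lambda_max M.
Proof.
move=> n0 MT.
have [x] := compact_EVT_max (sphere_nonempty n0) (@sphere_compact n)
  (continuous_subspaceT (@qform_continuous _ M)).
rewrite inE /= => x1 xmax.
have psdL : psd ((qform M x)%:M - M).
  split=> [|y]; first by rewrite linearB /= tr_scalar_mx MT.
  rewrite qformD -scaleN1r qformZ mulN1r -[(_ x)%:M]scalemx1 qformZ subr_ge0.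
  have [->|y0] := eqVneq y 0; first by rewrite /qform !mulmx0 mxE mulr0.
  have := xmax ((enorm y)^-1 *: y); rewrite inE /= => /(_ (enorm_normalize y0)).
  rewrite -enormE {1}/qform -scalemxAr [_^T]linearZ -!scalemxAl scalerA mxE.
  rewrite -/(qform M y) -invfM -expr2 mulrC ler_pdivrMr //.
  by rewrite exprn_gt0 ?enorm_gt0.
by rewrite (lambda_max_eq psdL x1 erefl); split => //; exists x.
Qed.

End MatrixLimits.

(** * Linear pencils of matrices and compactness *)

Section Pencil.
Variables (R : realType) (m n : nat) (G : 'I_m -> 'M[R]_n).
Implicit Types v p : 'cV[R]_m.

(** The map Phi_T, with an arbitrary family of matrices in place of the
    Gramians. *)
Definition pencil v : 'M[R]_n := \sum_i v i 0 *: G i.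

Lemma pencil_is_linear : linear pencil.
Proof.
move=> a u v; rewrite /pencil scaler_sumr -big_split /=; apply: eq_bigr => i _.
by rewrite !mxE scalerDl scalerA.
Qed.

HB.instance Definition _ :=
  GRing.isLinear.Build R 'cV[R]_m 'M[R]_n *:%R pencil pencil_is_linear.

Lemma pencil_delta i : pencil (delta_mx i 0) = G i.
Proof.
rewrite /pencil (bigD1 i) //= mxE !eqxx scale1r big1 ?addr0 // => j ji.
by rewrite mxE (negbTE ji) scale0r.
Qed.

End Pencil.

(** A finite sequence in S whose span has the largest dimension already spans every
    element of S, since adjoining one cannot enlarge the span.  The point is that
    linear spans become subspaces in the sense of linear algebra, described by
    projections. *)
Lemma lin_span (R : realType) m (S : set 'cV[R]_m) :
  exists U : {vspace 'cV[R]_m}, forall v, lin S v <-> v \in U.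
Proof.
pose P d := `[< exists2 X : seq 'cV[R]_m,
  (forall x, x \in X -> S x) & \dim <<X>> = d >].
have exP : exists d, P d.
  by exists (\dim <<[::] : seq 'cV[R]_m>>); apply/asboolP; exists [::].
have bP d : P d -> (d <= \dim {:'cV[R]_m})%N.
  by move=> /asboolP[X _ <-]; rewrite dimvS ?subvf.
case: (ex_maxnP exP bP) => d /asboolP[X XS dX] maxd.
exists <<X>>%VS => v; split=> [[k [c [u [uS ->]]]]|vX].
  apply: memv_suml => i _; apply: memvZ.
  have XuX : (<<X>> <= <<u i :: X>>)%VS by rewrite span_cons addvSr.
  have duX : (\dim <<u i :: X>> <= d)%N.
    apply: maxd; apply/asboolP; exists (u i :: X) => // x.
    by rewrite inE => /predU1P[->|/XS].
  have /eqP -> : <<X>>%VS == <<u i :: X>>%VS by rewrite eqEdim XuX dX.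
  by rewrite memv_span ?mem_head.
exists (size X), (fun i => coord (in_tuple X) i v), (fun i => X`_i); split.
  by move=> i; apply: XS; rewrite mem_nth.
exact: coord_span.
Qed.

Section Compactness.
Variables (R : realType) (m : nat).
Implicit Types (U : {vspace 'cV[R]_m}).

Lemma lincomb_continuous (V : normedModType R) (a : 'I_m -> V) :
  continuous (fun v : 'cV[R]_m => \sum_i v i 0 *: a i).
Proof.
apply: continuous_big => [|i _ v]; first exact: add_continuous.
exact: (cvgZr_tmp (@coord_continuous _ _ _ i 0 v)).
Qed.

Lemma pencil_continuous n (G : 'I_m -> 'M[R]_n) : continuous (pencil G).
Proof. exact: lincomb_continuous. Qed.

(** A subspace is the set of fixed points of a projection onto it, and a linear map
    of column vectors is continuous. *)
Lemma vspace_closed U : closed [set v | v \in U].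
Proof.
pose f := projv U.
have fE v : f v = \sum_i v i 0 *: f (delta_mx i 0).
  rewrite {1}(matrix_sum_delta v) exchange_big big_ord1 linear_sum.
  by apply: eq_bigr => i _; rewrite linearZ.
have cf : continuous (fun v => f v - v).
  have -> : (fun v => f v - v) =
    (fun v => \sum_i v i 0 *: f (delta_mx i 0) - v).
    by apply/funext => v; rewrite -fE.
  move=> v.
  exact: (cvgB (@lincomb_continuous _ (fun i => f (delta_mx i 0)) v) cvg_id).
have -> : [set v | v \in U] = (fun v => f v - v) @^-1` [set 0].
  apply/seteqP; split=> v /=; first by move=> vU; rewrite projv_id // subrr.
  by move/eqP; rewrite subr_eq0 => /eqP <-; exact: memv_proj.
apply: closed_comp; first by move=> v _; exact: cf.
apply: accessible_closed_set1; apply: hausdorff_accessible.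
exact: norm_hausdorff.
Qed.

Lemma frob_continuous n k : continuous (@frob R n k).
Proof.
move=> M; apply: continuous_comp; last exact: sqrt_continuous.
apply: continuous_big => [|i _]; first exact: add_continuous.
apply: continuous_big => [|j _]; first exact: add_continuous.
move=> N; have cN := @coord_continuous R n k i j N; exact: (cvgM cN cN).
Qed.

Lemma frobZ n k a (M : 'M[R]_(n, k)) : frob (a *: M) = `|a| * frob M.
Proof.
rewrite /frob -sqrtr_sqr -sqrtrM ?sqr_ge0 // mulr_sumr; congr Num.sqrt.
apply: eq_bigr => i _; rewrite mulr_sumr; apply: eq_bigr => j _.
by rewrite mxE exprMn.
Qed.

Lemma frob_gt0 n k (M : 'M[R]_(n, k)) : M != 0 -> 0 < frob M.
Proof.
move=> M0; rewrite lt0r sqrtr_ge0 andbT; apply: contra M0.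
have s0 i : 0 <= \sum_j M i j ^+ 2 by apply: sumr_ge0 => j _; exact: sqr_ge0.
rewrite sqrtr_eq0 => le0; apply/eqP/matrixP => i j; rewrite mxE; apply/eqP.
rewrite -sqrf_eq0; apply/eqP.
have /psumr_eq0P : forall i, true -> 0 <= \sum_j M i j ^+ 2 by [].
have /eqP -> : \sum_i \sum_j M i j ^+ 2 == 0.
  by rewrite eq_le le0 sumr_ge0.
move=> /(_ erefl i isT) /psumr_eq0P -> // l _; exact: sqr_ge0.
Qed.

Lemma is_min_set_min (E : set R) x : is_min E x -> is_min E (set_min E).
Proof. by move=> mx; exact: (xgetPex 0 (ex_intro _ x mx)). Qed.

(** Besides attainment, the last clause extends the bound from unit vectors to the
    whole subspace by homogeneity. *)
Lemma min_frob_pencil n (G : 'I_m -> 'M[R]_n) (U : {vspace 'cV[R]_m}) :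
  (exists2 v, v \in U & v != 0) ->
  (forall v, v \in U -> pencil G v = 0 -> v = 0) ->
  let E := [set frob (pencil G v) | v in [set v | v \in U /\ enorm v = 1]] in
  [/\ is_min E (set_min E), 0 < set_min E &
      forall v, v \in U -> set_min E * enorm v <= frob (pencil G v)].
Proof.
move=> [v0 v0U v0n] inj E.
pose K := [set v | v \in U] `&` [set v : 'cV[R]_m | enorm v = 1].
have cK : compact K.
  rewrite /K setIC; apply: compact_closedI; first exact: sphere_compact.
  exact: vspace_closed.
have K0 : K !=set0.
  by exists ((enorm v0)^-1 *: v0); split; [exact: memvZ|exact: enorm_normalize].
have cf : continuous (fun v => frob (pencil G v)).
  move=> v; apply: continuous_comp; first exact: pencil_continuous.
  exact: frob_continuous.
have [v] := compact_EVT_min K0 cK (continuous_subspaceT cf).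
rewrite inE => -[/= vU v1] vmin.
have minE : is_min E (set_min E).
  apply: (@is_min_set_min _ (frob (pencil G v))); split; first by exists v.
  by move=> _ [w [wU w1] <-]; apply: vmin; rewrite inE.
split=> //.
  case: minE => -[w [wU w1] <-] _; apply: frob_gt0.
  apply/eqP => /(inj _ wU) w0; move: w1; rewrite w0.
  by move/enorm_eq1; rewrite /qform mulmx0 mxE => /eqP; rewrite eq_sym oner_eq0.
move=> w wU; have [->|wn] := eqVneq w 0.
  by rewrite -(scale0r (0 : 'cV_m)) enormZ normr0 mul0r mulr0 sqrtr_ge0.
have wp := enorm_gt0 wn.
suff : set_min E <= (enorm w)^-1 * frob (pencil G w).
  by rewrite ler_pdivlMl // mulrC.
apply: minE.2; exists ((enorm w)^-1 *: w).
  by split; [exact: memvZ|exact: enorm_normalize].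
by rewrite linearZ /= frobZ ger0_norm ?invr_ge0 ?ltW.
Qed.

(** The form x^T W(p) x is maximised jointly over the compact product of C and the
    unit sphere; for the maximising p, the maximal value is the largest eigenvalue. *)
Lemma is_max_lambda_max n (W : 'cV[R]_m -> 'M[R]_n) (C : set 'cV[R]_m) :
  (0 < n)%N -> continuous W -> (forall p, (W p)^T = W p) ->
  C !=set0 -> compact C ->
  let E := [set lambda_max (W p) | p in C] in is_max E (set_max E).
Proof.
move=> n0 cW WT C0 cC E.
have cK := compact_setX cC (@sphere_compact R n).
have K0 : C `*` [set x : 'cV[R]_n | enorm x = 1] !=set0.
  by have [p pC] := C0; have [x x1] := sphere_nonempty R n0; exists (p, x).
pose f (z : 'cV[R]_m * 'cV[R]_n) := qform (W z.1) z.2.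
have cf : continuous f.
  move=> z; apply: cvg_qform; last exact: cvg_snd.
  by apply: continuous_comp; [exact: cvg_fst|exact: cW].
have [[p x]] := compact_EVT_max K0 cK (continuous_subspaceT cf).
rewrite inE => -[/= pC x1] pxmax.
suff mE : is_max E (lambda_max (W p)) by rewrite (is_max_set_max mE).
split; first by exists p.
move=> _ [q qC <-].
have [_ [y y1 <-]] := lambda_max_rayleigh n0 (WT q).
apply: le_trans (pxmax (q, y) _) _; first by rewrite inE.
have [[_ Wp_le] _] := lambda_max_rayleigh n0 (WT p).
move: (Wp_le x).
rewrite qformD -scaleN1r qformZ mulN1r subr_ge0.
by rewrite -[(lambda_max _)%:M]scalemx1 qformZ -enormE x1 expr1n mulr1.
Qed.
End Compactness.

(** * Directional derivatives of matrix functions *)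

Section DirectionalDerivatives.
Variables (R : realType) (V W : normedModType R).
Implicit Types (f : V -> W) (a v : V) (df : W).

Lemma is_deriveP f a v df : is_derive a v f df <->
  h^-1 *: (f (h *: v + a) - f a) @[h --> 0^'] --> df.
Proof.
split=> [[cf <-] //|cf]; apply: DeriveDef; first exact: (cvgP df).
exact: (cvg_lim _ cf).
Qed.

Lemma is_derive_cvg_line f a v df : is_derive a v f df ->
  f (h *: v + a) @[h --> 0^'] --> f a.
Proof.
move=> /is_deriveP cf.
have c0 : (h : R) @[h --> 0^'] --> (0 : R) by apply: nbhs_dnbhs.
have : h *: (h^-1 *: (f (h *: v + a) - f a)) + f a @[h --> 0^'] -->
       0 *: df + f a.
  by apply: cvgD; [exact: cvgZ|exact: cvg_cst].
rewrite scale0r add0r; apply: cvg_trans; apply: near_eq_cvg.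
near=> h; rewrite scalerA mulfV ?scale1r ?subrK //.
near: h; exact: nbhs_dnbhs_neq.
Unshelve. all: by end_near. Qed.

End DirectionalDerivatives.

(** A directional derivative only depends on the restriction to a line.  This gives
    the chain rule both for linear maps and for parametrised lines. *)
Lemma is_derive_affine (R : realType) (U V W : normedModType R)
    (L : U -> V) (f : V -> W) p u v df :
  (forall h, L (h *: u + p) = h *: v + L p) ->
  is_derive (L p) v f df <-> is_derive p u (f \o L) df.
Proof.
move=> Lline; rewrite !is_deriveP /=.
have -> // : (fun h => h^-1 *: (f (L (h *: u + p)) - f (L p))) =
             (fun h => h^-1 *: (f (h *: v + L p) - f (L p))).
by apply/funext => h; rewrite Lline.
Qed.

Lemma is_derive_line (R : realType) (V W : normedModType R)
    (f : V -> W) a v df :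
  is_derive a v f df <-> is_derive (0 : R) 1 (fun h => f (h *: v + a)) df.
Proof.
rewrite -(@is_derive_affine _ _ _ _ (fun h : R => h *: v + a) f 0 1 v).
  by rewrite scale0r add0r.
by move=> h; rewrite addr0 [h *: 1]mulr1 scale0r add0r.
Qed.

Section MatrixCalculus.
Variables (R : realType).

Lemma cvg_det (T : Type) (F : set_system T) n
    (M : T -> 'M[R]_n) (L : 'M[R]_n) :
  Filter F -> M x @[x --> F] --> L -> \det (M x) @[x --> F] --> \det L.
Proof.
move=> FF cM; rewrite /determinant.
apply: cvg_big => [|s _]; first exact: add_continuous.
apply: cvgM; first exact: cvg_cst.
by apply: cvg_big => [|i _]; [exact: mul_continuous|exact: cvg_mxE].
Qed.

Lemma cvg_adj (T : Type) (F : set_system T) n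
    (M : T -> 'M[R]_n) (L : 'M[R]_n) :
  Filter F -> M x @[x --> F] --> L -> \adj (M x) @[x --> F] --> \adj L.
Proof.
move=> FF cM; apply: cvg_mx => i j; rewrite mxE.
under eq_cvg do rewrite mxE.
apply: cvgM; first exact: cvg_cst.
apply: cvg_det; apply: cvg_mx => k l; rewrite !mxE.
by under eq_cvg do rewrite !mxE; exact: cvg_mxE.
Qed.

Lemma near_unitmx (T : Type) (F : set_system T) n
    (M : T -> 'M[R]_n) (L : 'M[R]_n) :
  Filter F -> L \in unitmx -> M x @[x --> F] --> L ->
  \forall x \near F, M x \in unitmx.
Proof.
move=> FF; rewrite unitmxE unitfE => uL /cvg_det cM.
near=> x; rewrite unitmxE unitfE.
near: x; exact: (cvgr_neq0 _ cM uL).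
Unshelve. all: by end_near. Qed.

(** By Cramer's rule the inverse is a quotient of polynomials in the entries whose
    denominator, the determinant, does not vanish near L. *)
Lemma cvg_invmx (T : Type) (F : set_system T) n
    (M : T -> 'M[R]_n) (L : 'M[R]_n) :
  Filter F -> L \in unitmx -> M x @[x --> F] --> L ->
  invmx (M x) @[x --> F] --> invmx L.
Proof.
move=> FF uL cM.
have uM := near_unitmx FF uL cM.
have : (\det (M x))^-1 *: \adj (M x) @[x --> F] --> invmx L.
  rewrite /invmx uL; apply: cvgZ; last exact: cvg_adj.
  by apply: cvgV; [move: uL; rewrite unitmxE unitfE|exact: cvg_det].
apply: cvg_trans; apply: near_eq_cvg.
by near=> x; rewrite /invmx ifT //; near: x.
Unshelve. all: by end_near. Qed.

Lemma cvg_mxtrace (T : Type) (F : set_system T) n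
    (M : T -> 'M[R]_n) (L : 'M[R]_n) :
  Filter F -> M x @[x --> F] --> L -> \tr (M x) @[x --> F] --> \tr L.
Proof.
move=> FF cM; rewrite /mxtrace.
by apply: cvg_big => [|i _]; [exact: add_continuous|exact: cvg_mxE].
Qed.

Lemma is_derive_mxtrace (U : normedModType R) n (M : U -> 'M[R]_n) a v dM :
  is_derive a v M dM -> is_derive a v (fun x => \tr (M x)) (\tr dM).
Proof.
move=> /is_deriveP cM; apply/is_deriveP.
have -> : (fun h : R => h^-1 *: (\tr (M (h *: v + a)) - \tr (M a))) =
          (fun h => \tr (h^-1 *: (M (h *: v + a) - M a))).
  by apply/funext => h; rewrite [RHS]linearZ [in RHS]raddfB.
exact: cvg_mxtrace.
Qed.

Lemma is_derive_mulmx (U : normedModType R) m n p (M : U -> 'M[R]_(m, n))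
    (N : U -> 'M[R]_(n, p)) a v dM dN :
  is_derive a v M dM -> is_derive a v N dN ->
  is_derive a v (fun x => M x *m N x) (dM *m N a + M a *m dN).
Proof.
move=> dMa dNa; apply/is_deriveP.
have -> : (fun h : R =>
    h^-1 *: (M (h *: v + a) *m N (h *: v + a) - M a *m N a)) =
  (fun h => (h^-1 *: (M (h *: v + a) - M a)) *m N (h *: v + a) +
            M a *m (h^-1 *: (N (h *: v + a) - N a))).
  apply/funext => h; rewrite -scalemxAl -scalemxAr -scalerDr mulmxBl mulmxBr.
  by rewrite addrA subrK.
apply: cvgD.
  by apply: cvg_mulmx; [exact/is_deriveP|exact: (is_derive_cvg_line dNa)].
by apply: cvg_mulmx; [exact: cvg_cst|exact/is_deriveP].
Qed.

(** The difference quotient is exactly - (P + h Q)^-1 Q P^-1, so continuity of the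
    inverse suffices. *)
Lemma is_derive_invmx n (P Q : 'M[R]_n) : P \in unitmx ->
  is_derive P Q (@invmx R n) (- (invmx P *m Q *m invmx P)).
Proof.
move=> uP; apply/is_deriveP.
have cP : h *: Q + P @[h --> (0 : R)^'] --> P.
  rewrite -[X in _ --> X]add0r -(scale0r Q).
  apply: cvgD; last exact: cvg_cst.
  by apply: cvgZr_tmp; apply: nbhs_dnbhs.
have : - (invmx (h *: Q + P) *m Q *m invmx P) @[h --> (0 : R)^'] -->
       - (invmx P *m Q *m invmx P).
  apply: cvgN; apply: cvg_mulmx; last exact: cvg_cst.
  by apply: cvg_mulmx; [exact: cvg_invmx|exact: cvg_cst].
apply: cvg_trans; apply: near_eq_cvg; near=> h.
have uh : h *: Q + P \in unitmx by near: h; apply: (near_unitmx _ uP cP).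
have h0 : h != 0 by near: h; exact: nbhs_dnbhs_neq.
apply: (scalerI h0); rewrite scalerA mulfV // scale1r.
have -> : invmx (h *: Q + P) - invmx P =
    invmx (h *: Q + P) *m (P - (h *: Q + P)) *m invmx P.
  by rewrite mulmxBr mulmxBl mulmxK // mulVmx // mul1mx.
by rewrite opprD addrCA subrr addr0 scalerN mulmxN mulNmx -scalemxAr -scalemxAl.
Unshelve. all: by end_near. Qed.

(** For h <> 0, det(1 + h M) is h^(n + 1) times the characteristic polynomial of
    - M at 1 / h: the polynomial r is that characteristic polynomial with its
    coefficients reversed, and its linear coefficient is the trace. *)
Lemma det_1addZ_poly n (M : 'M[R]_n.+1) :
  exists2 r : {poly R}, r`_1 = \tr M & forall h, \det (1%:M + h *: M) = r.[h].
Proof.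
pose c := char_poly (- M).
have cn : c`_n.+1 = 1.
  have /monicP := char_poly_monic (- M).
  by rewrite lead_coefE size_char_poly.
exists (\poly_(i < n.+2) c`_(n.+1 - i)).
  by rewrite coef_poly /= subSS subn0 char_poly_trace // linearN opprK.
move=> h; rewrite horner_poly; have [->|h0] := eqVneq h 0.
  rewrite scale0r addr0 det1 big_ord_recl expr0 mulr1 subn0 cn big1 ?addr0 //.
  by move=> i _; rewrite expr0n mulr0.
have -> : 1%:M + h *: M = h *: (h^-1%:M - - M).
  by rewrite opprK scalerDr scale_scalar_mx mulfV.
have -> : \det (h *: (h^-1%:M - - M)) = h ^+ n.+1 * c.[h^-1].
  rewrite detZ; congr (_ * _).
  rewrite -[RHS]/(horner_eval _ c) /c -det_map_mx; congr (\det _).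
  apply/matrixP => i j; rewrite !mxE /= /horner_eval.
  by rewrite hornerD hornerN hornerMn hornerX hornerC.
rewrite (@horner_coef_wide _ n.+2) ?size_char_poly // mulr_sumr.
rewrite (reindex_inj rev_ord_inj); apply: eq_bigr => i _ /=.
rewrite subSS mulrCA; congr (_ * _).
have -> : h ^+ n.+1 = h ^+ (n.+1 - i) * h ^+ i by rewrite -exprD subnK ?leq_ord.
by rewrite exprVn mulrAC mulfV ?mul1r ?expf_neq0.
Qed.

(** Jacobi's formula, read off the linear coefficient in [det_1addZ_poly] after
    factoring out det P. *)
Lemma is_derive_det n (P Q : 'M[R]_n) : P \in unitmx ->
  is_derive P Q (@determinant R n) (\det P * \tr (invmx P *m Q)).
Proof.
case: n P Q => [|n] P Q uP.
  rewrite /mxtrace big_ord0 mulr0.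
  have -> : @determinant R 0 = cst 1 by apply/funext => M; rewrite det_mx00.
  exact: is_derive_cst.
have [r rM rE] := det_1addZ_poly (invmx P *m Q).
apply/is_derive_line.
have -> : (fun h => \det (h *: Q + P)) = (fun h => ((\det P)%:P * r).[h]).
  apply/funext => h; rewrite hornerM hornerC -rE -det_mulmx mulmxDr mulmx1.
  by rewrite -scalemxAr mulKVmx // addrC.
apply: is_derive_eq (is_derive_poly _ _) _.
by rewrite derivM derivC mul0r add0r hornerM hornerC horner_coef0 coef_deriv rM.
Qed.

Lemma is_derive_ln_det n (P Q : 'M[R]_n) : 0 < \det P ->
  is_derive P Q (fun M => ln (\det M)) (\tr (invmx P *m Q)).
Proof.
move=> dP; have uP : P \in unitmx by rewrite unitmxE unitfE gt_eqF.
apply/is_derive_line.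
pose g (h : R) := \det (h *: Q + P).
have g0 : g 0 = \det P by rewrite /g scale0r add0r.
have dg : is_derive (0 : R) 1 g (\det P * \tr (invmx P *m Q)).
  exact: (is_derive_line _ _ _ _).1 (is_derive_det Q uP).
have dl : is_derive (g 0) 1 (@ln R) (g 0)^-1.
  by apply: is_derive1_ln; rewrite g0.
apply: is_derive_eq (is_derive1_comp dl dg) _.
by rewrite g0 mulKf // gt_eqF.
Qed.

End MatrixCalculus.

(** * Gradients and Hessians along a pencil *)

(** The mean value theorem is used twice: f1 s - c s is nondecreasing, hence so is
    f s - f1 0 * s - c s^2 / 2. *)
Lemma taylor2_ge (R : realType) (f f1 f2 : R -> R) (c : R) :
  (forall s : R, 0 <= s <= 1 -> is_derive s 1 f (f1 s)) ->
  (forall s : R, 0 <= s <= 1 -> is_derive s 1 f1 (f2 s)) ->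
  (forall s : R, 0 <= s <= 1 -> c <= f2 s) ->
  f 0 + f1 0 + c / 2 <= f 1.
Proof.
move=> df df1 f2c.
have cont (g dg : R -> R) :
    (forall s : R, 0 <= s <= 1 -> is_derive s 1 g (dg s)) ->
    {within `[0, 1 : R], continuous (g : R -> R)}.
  move=> dgs; apply: derivable_within_continuous => s.
  by rewrite in_itv /= => /dgs [].
have mvt (g dg : R -> R) s :
    (forall s : R, 0 <= s <= 1 -> is_derive s 1 g (dg s)) ->
    (forall s : R, 0 <= s <= 1 -> 0 <= dg s) -> 0 <= s <= 1 -> g 0 <= g s :> R.
  move=> dgs dg0 /andP[s0 s1].
  have dg_in t : t \in `]0, s[%R -> is_derive t 1 g (dg t).
    rewrite in_itv /= => /andP[t0 ts]; apply: dgs.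
    by rewrite (ltW t0) (le_trans (ltW ts)).
  have cg : {within `[0, s], continuous g}.
    apply: continuous_subspaceW (cont _ _ dgs) => t /=.
    by rewrite !in_itv /= => /andP[-> ts]; rewrite (le_trans ts).
  have [t] := MVT_segment s0 dg_in cg.
  rewrite in_itv /= => /andP[t0 ts] gE.
  by rewrite -subr_ge0 gE mulr_ge0 ?subr_ge0 // dg0 // t0 (le_trans ts).
pose g1 s := f1 s - c * s.
have g1_ge s : 0 <= s <= 1 -> f1 0 + c * s <= f1 s.
  move=> s01; have := mvt g1 (fun s => f2 s - c) s.
  rewrite /g1 mulr0 subr0 lerBrDr; apply=> // t t01.
    by have d1 := df1 t t01; apply: is_derive_eq; rewrite /GRing.scale /=; ring.
  by rewrite subr_ge0 f2c.
pose g s := f s - f1 0 * s - c / 2 * (s * s).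
have := mvt g (fun s => f1 s - f1 0 - c * s) 1.
rewrite /g !mulr0 !subr0 !mulr1 => H.
rewrite -addrA -lerBrDr opprD addrA; apply: H; rewrite ?lexx ?ler01 //.
  move=> t t01; have d0 := df t t01.
  by apply: is_derive_eq; rewrite /GRing.scale /=; field.
by move=> t /g1_ge; rewrite -addrA -opprD subr_ge0.
Qed.

Section PencilCalculus.
Variables (R : realType) (m n : nat) (G : 'I_m -> 'M[R]_n).
Implicit Types (p q v : 'cV[R]_m).

Local Notation W := (pencil G).
Local Notation S p := (invmx (W p)).
Local Notation gV := (fun p => - ln (\det (W p))).
Local Notation gA := (fun p => \tr (S p)).

Lemma pencil_line p v h : W (h *: v + p) = h *: W v + W p.
Proof. exact: linearP. Qed.

Lemma is_derive_logdet_pencil p v : 0 < \det (W p) ->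
  is_derive p v gV (- \tr (S p *m W v)).
Proof.
move=> dp; have dl := is_derive_ln_det (W v) dp.
have /is_deriveN := (is_derive_affine _ _ (pencil_line p v)).1 dl.
exact.
Qed.

Lemma is_derive_inv_pencil p v : W p \in unitmx ->
  is_derive p v (fun q => S q) (- (S p *m W v *m S p)).
Proof.
move=> up; have dl := is_derive_invmx (W v) up.
exact: (is_derive_affine _ _ (pencil_line p v)).1 dl.
Qed.

Lemma is_derive_trinv_pencil p v : W p \in unitmx ->
  is_derive p v gA (- \tr (S p *m W v *m S p)).
Proof.
move=> /(is_derive_inv_pencil v)/is_derive_mxtrace; rewrite raddfN; exact.
Qed.

Lemma is_derive_trinvl_pencil p v U : W p \in unitmx ->
  is_derive p v (fun q => - \tr (S q *m U)) (\tr (S p *m W v *m S p *m U)).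
Proof.
move=> /(is_derive_inv_pencil v) dS.
have dSU := is_derive_mulmx dS (is_derive_cst U p v).
have := is_deriveN (is_derive_mxtrace dSU).
by rewrite mulmx0 addr0 mulNmx raddfN opprK.
Qed.

Lemma is_derive_trinvlr_pencil p v U : W p \in unitmx ->
  is_derive p v (fun q => - \tr (S q *m U *m S q))
    (\tr (S p *m W v *m S p *m U *m S p) + \tr (S p *m U *m S p *m W v *m S p)).
Proof.
move=> /(is_derive_inv_pencil v) dS.
have dSU := is_derive_mulmx dS (is_derive_cst U p v).
have := is_deriveN (is_derive_mxtrace (is_derive_mulmx dSU dS)).
rewrite mulmx0 addr0 !mulNmx mulmxN -opprD raddfN opprK raddfD /= !mulmxA.
exact.
Qed.

(** A second partial derivative needs the formula for the first one on a
    neighbourhood.  These formulas hold as soon as the determinant is positive, an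
    evidently open condition. *)
Lemma near_pencil_det_gt0 p :
  0 < \det (W p) -> \forall q \near p, 0 < \det (W q).
Proof.
move=> dp; have := cvg_det _ (@pencil_continuous R m n G p).
by move=> /(_ _)/cvgr_gt; apply.
Qed.

Lemma hess_logdet_pencil p i j : 0 < \det (W p) ->
  hess gV p i j = \tr (S p *m G i *m S p *m G j).
Proof.
move=> dp; rewrite mxE.
have up : W p \in unitmx by rewrite unitmxE unitfE gt_eqF.
have nE : \forall q \near p, - \tr (S q *m G j) = partial j gV q.
  near=> q; rewrite /partial -[G j](pencil_delta G).
  apply/esym/derive_val; apply: is_derive_logdet_pencil.
  by near: q; exact: near_pencil_det_gt0.
have := near_eq_is_derive nE (is_derive_trinvl_pencil (delta_mx i 0) (G j) up).
by rewrite pencil_delta => d; apply: derive_val.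
Unshelve. all: by end_near. Qed.

Lemma hess_trinv_pencil p i j : 0 < \det (W p) ->
  hess gA p i j = \tr (S p *m G i *m S p *m G j *m S p) +
                  \tr (S p *m G j *m S p *m G i *m S p).
Proof.
move=> dp; rewrite mxE.
have up : W p \in unitmx by rewrite unitmxE unitfE gt_eqF.
have nE : \forall q \near p, - \tr (S q *m G j *m S q) = partial j gA q.
  near=> q; rewrite /partial -[G j](pencil_delta G).
  apply/esym/derive_val; apply: is_derive_trinv_pencil.
  rewrite unitmxE unitfE gt_eqF //.
  by near: q; exact: near_pencil_det_gt0.
have := near_eq_is_derive nE (is_derive_trinvlr_pencil (delta_mx i 0) (G j) up).
by rewrite pencil_delta => d; apply: derive_val.
Unshelve. all: by end_near. Qed.

(** Hessian entries that are bilinear in G i and G j assemble, by linearity of the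
    pencil, into the same expression at W v. *)
Lemma pencil_trace_form (A B : 'M[R]_n) (H : 'M[R]_m) v :
  (forall i j, H i j = \tr (A *m G i *m B *m G j)) ->
  (v^T *m H *m v) 0 0 = \tr (A *m W v *m B *m W v).
Proof.
move=> HE; rewrite {2}/pencil mulmx_sumr raddf_sum /= mxE.
apply: eq_bigr => j _; rewrite -scalemxAr linearZ /= mulrC; congr (_ * _).
rewrite /pencil mulmx_sumr !mulmx_suml raddf_sum /= mxE.
apply: eq_bigr => i _; rewrite mxE HE.
by rewrite -scalemxAr -!scalemxAl linearZ.
Qed.

Lemma hess_logdet_form p v : 0 < \det (W p) ->
  (v^T *m hess gV p *m v) 0 0 = \tr (S p *m W v *m S p *m W v).
Proof.
by move=> dp; apply: pencil_trace_form => i j; exact: hess_logdet_pencil.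
Qed.

Lemma hess_trinv_form p v : 0 < \det (W p) ->
  (v^T *m hess gA p *m v) 0 0 = 2 * \tr (S p *m W v *m S p *m W v *m S p).
Proof.
move=> dp; pose SS := S p *m S p.
pose H (A B : 'M[R]_n) : 'M[R]_m := \matrix_(i, j) \tr (A *m G i *m B *m G j).
have -> : hess gA p = H SS (S p) + H (S p) SS.
  apply/matrixP => i j; rewrite hess_trinv_pencil // !mxE; congr (_ + _).
    by rewrite mxtrace_mulC !mulmxA.
  by rewrite -2!(mulmxA (S p *m G j)) mxtrace_mulC !mulmxA.
rewrite mulmxDr mulmxDl mxE.
rewrite !(pencil_trace_form _ (fun i j => mxE _ _ i j)).
have -> : \tr (S p *m W v *m SS *m W v) = \tr (SS *m W v *m S p *m W v).
  by rewrite -(mulmxA (S p *m W v)) mxtrace_mulC mulmxA.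
by rewrite [X in _ = 2 * X]mxtrace_mulC !mulmxA; ring.
Qed.

End PencilCalculus.

(** * Symmetry of the Gramians and strong convexity along segments *)

Section GramianSymmetry.
Variable R : realType.

(** Transposition is a homeomorphism, and it fixes the default value that the limit
    of a divergent sequence takes. *)
Lemma trmx_limn n (u : nat -> 'M[R]_n) : (limn u)^T = limn (fun k => (u k)^T).
Proof.
have [cu|ncu] := pselect (cvgn u).
  by apply/esym/cvg_lim => //; exact: cvg_trmx.
have ncuT : ~ cvgn (fun k => (u k)^T).
  move=> /cvg_trmx; under eq_cvg do rewrite trmxK.
  by move=> /cvgP/ncu.
have dvg (w : nat -> 'M[R]_n) : ~ cvgn w -> limn w = point.
  move=> ncw; apply: xgetPN => l wl; apply: ncw; exact: (cvgP l).
rewrite (dvg _ ncu) (dvg _ ncuT).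
by apply/matrixP => i j; rewrite mxE [LHS]mxE [RHS]mxE.
Qed.

Lemma trmx_expmx n (M : 'M[R]_n) : (expmx M)^T = expmx M^T.
Proof.
rewrite /expmx trmx_limn; congr (limn _); apply/funext => N.
rewrite /series /= raddf_sum /=; apply: eq_bigr => k _.
rewrite linearZ /=; congr (_ *: _).
elim: k => [|k IHk]; first by rewrite !expr0 trmx1.
by rewrite exprS exprSr [LHS]trmx_mul IHk.
Qed.

(** The integrand is symmetric at every time, since transposition exchanges the
    exponentials of t A and of t A^T. *)
Lemma gramian_sym n m (A : 'M[R]_n) (b : 'I_m -> 'cV[R]_n) T i :
  (gramian A b T i)^T = gramian A b T i.
Proof.
pose F (t : R) := expmx (t *: A) *m b i *m (b i)^T *m expmx (t *: A^T).
have FT t : (F t)^T = F t.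
  have tZ (M : 'M[R]_n) : (t *: M)^T = t *: M^T by rewrite [LHS]linearZ.
  by rewrite /F !trmx_mul trmxK !trmx_expmx !tZ trmxK !mulmxA.
rewrite /gramian -/F; apply/matrixP => j k; rewrite !mxE.
by congr (Rintegral _ _ _); apply/funext => t; rewrite -[in LHS]FT mxE.
Qed.

End GramianSymmetry.

Lemma posdef_conv (R : realType) n (M N : 'M[R]_n) (s : R) : 0 <= s <= 1 ->
  posdef M -> posdef N -> posdef (s *: M + (1 - s) *: N).
Proof.
move=> /andP[s0 s1] [MT M0] [NT N0]; split=> [|x x0].
  by rewrite raddfD /= !linearZ /= MT NT.
rewrite -/(qform _ x) qformD !qformZ.
have Mx := M0 _ x0; have Nx := N0 _ x0; rewrite -!/(qform _ x) in Mx Nx.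
have [->|sn1] := eqVneq s 1; first by rewrite subrr mul0r addr0 mul1r.
rewrite ltr_wpDl ?mulr_ge0 ?(ltW Mx) // mulr_gt0 // subr_gt0 lt_neqAle sn1 //.
Qed.

Lemma convex_segment (R : realType) m (C : set 'cV[R]_m) p q s :
  convex_set C -> C p -> C q -> 0 <= s <= 1 -> C (s *: (q - p) + p).
Proof.
move=> cC Cp Cq /andP[s0 s1].
have := cC q p (Itv01 s0 s1); rewrite !inE => /(_ Cq Cp).
suff -> : s *: (q - p) + p = s *: q + (1 - s) *: p by [].
by rewrite scalerBr scalerBl scale1r addrA addrAC.
Qed.

(** Here f1 p v and f2 p v stand for the first and second derivatives of f at p in
    direction v.  Linearity of f1 p in v is what identifies it with the gradient. *)
Lemma strongly_convex_on_of_derive (R : realType) m (S : set 'cV[R]_m)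
    (f : 'cV[R]_m -> R) (f1 f2 : 'cV[R]_m -> 'cV[R]_m -> R) mu :
  (forall p q s, S p -> S q -> 0 <= s <= 1 -> S (s *: (q - p) + p)) ->
  (forall p v, S p -> is_derive p v f (f1 p v)) ->
  (forall p v, f1 p v = \sum_i f1 p (delta_mx i 0) * v i 0) ->
  (forall p v, S p -> is_derive p v (f1 ^~ v) (f2 p v)) ->
  (forall r p q, S r -> S p -> S q ->
    mu * enorm (q - p) ^+ 2 <= f2 r (q - p)) ->
  strongly_convex_on S f mu.
Proof.
move=> convS df f1_sum df1 f2_ge p q Sp Sq; set v := q - p.
have -> : ((grad f p)^T *m v) 0 0 = f1 p v.
  rewrite f1_sum mxE; apply: eq_bigr => i _; rewrite !mxE /partial.
  by rewrite (@derive_val _ _ _ _ _ _ _ (df p (delta_mx i 0) Sp)).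
have line t h : (h *: (1 : R) + t) *: v + p = h *: v + (t *: v + p).
  by rewrite scalerDl [h *: 1]mulr1 addrA.
pose L (s : R) := s *: v + p.
have SL s : 0 <= s <= 1 -> S (L s) by move=> s01; exact: convS.
have := @taylor2_ge R (f \o L) (fun s => f1 (L s) v) (fun s => f2 (L s) v)
  (mu * enorm v ^+ 2).
rewrite /L /= scale0r add0r scale1r subrK -/v => H.
rewrite mulrAC; apply: H => s s01.
- by apply/(is_derive_affine _ _ (line s)); exact/df/SL.
- by apply/(is_derive_affine (f1 ^~ v) _ (line s)); exact/df1/SL.
- exact/f2_ge/Sq/Sp/SL.
Qed.

(** * Curvature bounds and the theorem *)

Section PencilBounds.
Variables (R : realType) (m n : nat) (G : 'I_m -> 'M[R]_n).
Hypothesis G_sym : forall i, (G i)^T = G i.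
Implicit Types (p q v : 'cV[R]_m).

Local Notation W := (pencil G).
Local Notation S p := (invmx (W p)).
Local Notation gV := (fun p => - ln (\det (W p))).
Local Notation gA := (fun p => \tr (S p)).

Lemma pencil_sym v : (W v)^T = W v.
Proof.
rewrite /pencil raddf_sum; apply: eq_bigr => i _.
by rewrite [LHS]linearZ /= G_sym.
Qed.

(** Both first derivatives have this form, which makes them linear in the
    direction. *)
Lemma trace_pencil_sum (A B : 'M[R]_n) v :
  - \tr (A *m W v *m B) = \sum_i - \tr (A *m W (delta_mx i 0) *m B) * v i 0.
Proof.
under eq_bigr do rewrite mulNr.
rewrite sumrN; congr (- _).
rewrite {1}/pencil mulmx_sumr mulmx_suml [LHS]raddf_sum /=.
apply: eq_bigr => i _.
by rewrite pencil_delta -scalemxAr -scalemxAl linearZ /= mulrC.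
Qed.

Variables (p v : 'cV[R]_m) (kap bet : R).
Hypotheses (n_gt0 : (0 < n)%N) (p_posdef : posdef (W p)).
Hypotheses (bet_ge : lambda_max (W p) <= bet) (kap_ge0 : 0 <= kap).
Hypothesis (kap_le : kap * enorm v <= frob (W v)).

Let lam := lambda_max (W p).

Let lam_gt0 : 0 < lam.
Proof.
rewrite /lam; have [_ [x x1 <-]] := lambda_max_rayleigh n_gt0 (pencil_sym p).
apply: p_posdef.2; apply/eqP => x0; move: x1.
rewrite x0 => /enorm_eq1; rewrite /qform mulmx0 mxE => /eqP.
by rewrite eq_sym oner_eq0.
Qed.

Let frob_le k :
  kap ^+ 2 / bet ^+ k * enorm v ^+ 2 <= frob (W v) ^+ 2 / lam ^+ k.
Proof.
have en0 : 0 <= enorm v by exact: sqrtr_ge0.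
rewrite mulrAC -exprMn ler_pM ?exprn_ge0 ?mulr_ge0 //.
- by rewrite invr_ge0 exprn_ge0 // (le_trans (ltW lam_gt0)).
- by rewrite lerXn2r ?nnegrE ?mulr_ge0 // sqrtr_ge0.
rewrite lef_pV2 ?posrE ?exprn_gt0 ?(lt_le_trans lam_gt0) //.
by rewrite lerXn2r ?nnegrE ?(ltW lam_gt0) // (le_trans (ltW lam_gt0)).
Qed.

Let psd_lam : psd (lam%:M - W p).
Proof. by have [] := lambda_max_rayleigh n_gt0 (pencil_sym p). Qed.

Lemma hess_logdet_ge :
  kap ^+ 2 / bet ^+ 2 * enorm v ^+ 2 <= (v^T *m hess gV p *m v) 0 0.
Proof.
rewrite hess_logdet_form ?posdef_det_gt0 //; apply: le_trans (frob_le 2) _.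
exact: (trace_invmx2_ge p_posdef lam_gt0 psd_lam (pencil_sym v)).
Qed.

Lemma hess_trinv_ge :
  2 * kap ^+ 2 / bet ^+ 3 * enorm v ^+ 2 <= (v^T *m hess gA p *m v) 0 0.
Proof.
rewrite hess_trinv_form ?posdef_det_gt0 // -2!(mulrA 2) ler_pM2l //.
apply: le_trans (frob_le 3) _.
exact: (trace_invmx3_ge p_posdef lam_gt0 psd_lam (pencil_sym v)).
Qed.

End PencilBounds.

Section PencilStrongConvexity.
Variables (R : realType) (m n : nat) (G : 'I_m -> 'M[R]_n) (D : set 'cV[R]_m).

Local Notation W := (pencil G).
Local Notation S p := (invmx (W p)).
Local Notation gV := (fun p => - ln (\det (W p))).
Local Notation gA := (fun p => \tr (S p)).

Hypothesis D_posdef : forall p, D p -> posdef (W p).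
Hypothesis D_convex :
  forall p q s, D p -> D q -> 0 <= s <= 1 -> D (s *: (q - p) + p).

Let D_det p : D p -> 0 < \det (W p).
Proof. by move=> /D_posdef/posdef_det_gt0. Qed.

Let D_unit p : D p -> W p \in unitmx.
Proof. by move=> /D_posdef/posdef_unit. Qed.

Lemma strongly_convex_logdet mu :
  (forall r p q, D r -> D p -> D q ->
    mu * enorm (q - p) ^+ 2 <= ((q - p)^T *m hess gV r *m (q - p)) 0 0) ->
  strongly_convex_on D gV mu.
Proof.
move=> hge; apply: (@strongly_convex_on_of_derive _ _ _ _
  (fun p v => - \tr (S p *m W v))
  (fun p v => \tr (S p *m W v *m S p *m W v))) => //.
- by move=> p v /D_det; exact: is_derive_logdet_pencil.
- move=> p v; have := trace_pencil_sum G (S p) 1%:M v.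
  by rewrite mulmx1; under eq_bigr do rewrite mulmx1.
- by move=> p v /D_unit; exact: is_derive_trinvl_pencil.
by move=> r p q Dr Dp Dq; rewrite -hess_logdet_form ?hge ?D_det.
Qed.

Lemma strongly_convex_trinv mu :
  (forall r p q, D r -> D p -> D q ->
    mu * enorm (q - p) ^+ 2 <= ((q - p)^T *m hess gA r *m (q - p)) 0 0) ->
  strongly_convex_on D gA mu.
Proof.
move=> hge; apply: (@strongly_convex_on_of_derive _ _ _ _
  (fun p v => - \tr (S p *m W v *m S p))
  (fun p v => \tr (S p *m W v *m S p *m W v *m S p) +
              \tr (S p *m W v *m S p *m W v *m S p))) => //.
- by move=> p v /D_unit; exact: is_derive_trinv_pencil.
- by move=> p v; exact: trace_pencil_sum.
- by move=> p v /D_unit; exact: is_derive_trinvlr_pencil.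
move=> r p q Dr Dp Dq; rewrite -[X in _ <= X]mulr2n -mulr_natl.
by rewrite -hess_trinv_form ?hge ?D_det.
Qed.

End PencilStrongConvexity.

Theorem lemma6 (R : realType) (n m : nat) (A : 'M[R]_n)
    (b : 'I_m -> 'cV[R]_n) (T : R) (C : set 'cV[R]_m)
    (m_ge1 : (1 <= m)%N) (T_gt0 : 0 < T)
    (C_simplex : C `<=` simplex (m:=m))
    (C_nonempty : C !=set0) (C_compact : compact C) (C_convex : convex_set C)
    (ker_Phi : Phi A b T @^-1` [set 0] `&` L_ C = [set 0])
    (C_X : C `&` X_ A b T !=set0)
    (L_neq0 : L_ C <> [set 0]) :
  [/\ (* the minimum and the maximum defining kappa and beta are attained *)
      is_min (kappa_set A b T C) (kappa A b T C),
      is_max (beta_set A b T C) (beta A b T C),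
      0 < kappa A b T C,
      (forall p v, (C `&` X_ A b T) p -> L_ C v ->
         (v^T *m hess (fV A b T) p *m v) 0 0 >= muV A b T C * enorm v ^+ 2 /\
         (v^T *m hess (fA A b T) p *m v) 0 0 >= muA A b T C * enorm v ^+ 2) &
      strongly_convex_on (C `&` X_ A b T) (fV A b T) (muV A b T C) /\
      strongly_convex_on (C `&` X_ A b T) (fA A b T) (muA A b T C)].
Proof.
have G_sym := gramian_sym A b T; set G := gramian A b T in G_sym.
have PhiE : Phi A b T = pencil G by [].
have [U LU] := lin_span [set p - q | p in C & q in C].
have [v0 v0U v0n] : exists2 v, v \in U & v != 0.
  apply: contrapT => no; apply: L_neq0; apply/seteqP; split=> v /=.
    move=> /LU vU; apply/eqP; apply: contraT => vn; exfalso; apply: no.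
    by exists v.
  by move=> ->; apply/LU; exact: mem0v.
have inj v : v \in U -> pencil G v = 0 -> v = 0.
  move=> vU Wv; have : (Phi A b T @^-1` [set 0] `&` L_ C) v.
    by split=> //; exact/LU.
  by rewrite ker_Phi.
have n_gt0 : (0 < n)%N.
  case: (posnP n) => // n0; case/eqP: v0n; apply: inj => //.
  by apply/matrixP => i; have := leq_trans (ltn_ord i) (eq_leq n0).
have [kmin kpos kle] := min_frob_pencil (ex_intro2 _ _ v0 v0U v0n) inj.
have KE : kappa_set A b T C =
    [set frob (pencil G v) | v in [set v | v \in U /\ enorm v = 1]].
  rewrite /kappa_set PhiE; congr image; apply/seteqP.
  by split=> v /= [/LU].
rewrite -KE -/(kappa A b T C) in kmin kpos kle.
have bmax : is_max (beta_set A b T C) (beta A b T C).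
  apply: is_max_lambda_max => //; first exact: pencil_continuous.
  by move=> p; exact: pencil_sym.
have hV p v : (C `&` X_ A b T) p -> L_ C v ->
    muV A b T C * enorm v ^+ 2 <= (v^T *m hess (fV A b T) p *m v) 0 0 /\
    muA A b T C * enorm v ^+ 2 <= (v^T *m hess (fA A b T) p *m v) 0 0.
  move=> [Cp Xp] /LU vU.
  have lb : lambda_max (pencil G p) <= beta A b T C by apply: bmax.2; exists p.
  have k0 := ltW kpos.
  by split; [apply: hess_logdet_ge|apply: hess_trinv_ge] => //; exact: kle.
have DX p : (C `&` X_ A b T) p -> posdef (pencil G p) by case.
have Dconv p q s : (C `&` X_ A b T) p -> (C `&` X_ A b T) q -> 0 <= s <= 1 ->
    (C `&` X_ A b T) (s *: (q - p) + p).
  move=> [Cp Xp] [Cq Xq] s01; split; first exact: convex_segment.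
  rewrite /X_ /= PhiE.
  have -> : s *: (q - p) + p = s *: q + (1 - s) *: p.
    by rewrite scalerBr scalerBl scale1r addrA addrAC.
  by rewrite linearD !linearZ /=; exact: posdef_conv.
have Ldiff p q : C p -> C q -> L_ C (q - p).
  move=> Cp Cq; exists 1%N, (fun=> 1), (fun=> q - p); split.
    by move=> _; exists q => //; exists p.
  by rewrite big_ord1 scale1r.
split=> //; split.
- apply: (strongly_convex_logdet DX Dconv) => r p q Dr [Cp _] [Cq _].
  exact: (hV r (q - p) Dr (Ldiff _ _ Cp Cq)).1.
- apply: (strongly_convex_trinv DX Dconv) => r p q Dr [Cp _] [Cq _].
  exact: (hV r (q - p) Dr (Ldiff _ _ Cp Cq)).2.
Qed.
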